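(* Let $n\ge 2$ be an integer and let $\alpha>0$ be a scaling parameter. Let $B(n)$ be the symmetric tridiagonal $n\times n$ matrix with $$B_{ii} = n\ (1\le i\le n),\qquad B_{i,i+1} = B_{i+1,i} = -\tfrac12\sqrt{i(2n-i-1)}\ (1\le i\le n-2),\qquad B_{n-1,n} = B_{n,n-1} = -\sqrt{\tfrac{n(n-1)}{2}},$$ and all other entries zero. Define $$m_n = \alpha^2,\qquad m_{n-i} = 2\alpha^2\,\frac{(n+i-1)!\,(n-i-1)!}{((n-1)!)^2}\quad (i=1,\dots,n-1),$$ $$k_1 = \alpha^2\,\frac{(2n-1)!}{((n-1)!)^2},\qquad k_{i+1} = \alpha^2\,\frac{i!\,(2n-i-1)!}{((n-1)!)^2}\quad (i=1,\dots,n-1).$$ Let $M = \mathrm{diag}(m_1,\dots,m_n)$ and let $C$ be the symmetric tridiagonal $n\times n$ matrix with $$C_{ii} = k_i + k_{i+1}\ (1\le i\le n-1),\qquad C_{nn} = k_n,\qquad C_{i,i+1}=C_{i+1,i} = -k_{i+1}\ (1\le i\le n-1),$$ and all other entries zero. Then $\mathbf{u} = (m_1^{1/2},\dots,m_n^{1/2})^T$ satisfies $B(n)\mathbf{u} = (m_1^{-1/2}k_1,0,\dots,0)^T$, and $C = M^{1/2}B(n)M^{1/2}$, i.e. $M^{-1/2}CM^{-1/2}=B(n)$. Consequently these masses $m_i$ and stiffnesses $k_i$ give an explicit solution of the inverse problem with the following spectra: the values $\lambda$ for which $(C-\lambda M)\mathbf{x}=\mathbf{0}$ has a nonzero solution $\mathbf{x}$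 are exactly $\{1,3,\dots,2n-1\}$, and the values $\lambda^o$ for which $(C^o-\lambda^o M^o)\mathbf{x}^o=\mathbf{0}$ has a nonzero solution $\mathbf{x}^o$ are exactly $\{2,4,\dots,2n-2\}$, where $C^o$ and $M^o$ are obtained from $C$ and $M$ by deleting the last row and column.
   Context: This describes a spring-mass chain of masses $m_1,\dots,m_n$ with spring stiffnesses $k_1,\dots,k_n$, where spring $k_1$ joins a fixed wall to $m_1$ and spring $k_{i+1}$ joins $m_i$ to $m_{i+1}$. The generalized eigenvalues of $(C,M)$ are called the natural frequencies of the system with the right-hand end free, and those of $(C^o,M^o)$ the natural frequencies of the system with the right-hand end ($m_n$) fixed. $M^{1/2}$ and $M^{-1/2}$ are the diagonal matrices with entries $m_i^{1/2}$ and $m_i^{-1/2}$. *)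

(* Defs.v *)
From mathcomp Require Import all_boot all_order all_algebra.
Set Implicit Arguments.
Unset Strict Implicit.
Unset Printing Implicit Defensive.
Import Order.TTheory GRing.Theory Num.Theory.
Local Open Scope ring_scope.

(* Sequences d, e, m, k : nat -> R are indexed from 1 as in the usual physical
   numbering, so row (or column) i : 'I_n of a matrix carries the index i.+1. *)

(* Symmetric tridiagonal: the (j, j) entry is d j, and the (j, j + 1) and
   (j + 1, j) entries are e j. *)
Definition sym_tridiag (R : rcfType) (n : nat) (d e : nat -> R) : 'M[R]_n :=
  \matrix_(i < n, j < n)
    if i == j :> nat then d i.+1
    else if j == i.+1 :> nat then e i.+1
    else if i == j.+1 :> nat then e j.+1
    else 0.

Definition Bmx (R : rcfType) (n : nat) : 'M[R]_n :=
  sym_tridiag n (fun=> n%:R)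
    (fun i => if i == n.-1
              then - Num.sqrt (n%:R * (n%:R - 1) / 2)
              else - (1 / 2 * Num.sqrt (i%:R * (2 * n%:R - i%:R - 1)))).

(* For 1 <= j < n the closed form for m_{n-i} is used at i = n - j; outside
   1 <= j <= n the value is irrelevant. *)
Definition mass (R : rcfType) (alpha : R) (n j : nat) : R :=
  if j == n then alpha ^+ 2
  else let i := (n - j)%N in
    2 * alpha ^+ 2 * (((n + i - 1)`!)%:R * ((n - i - 1)`!)%:R)
      / ((n - 1)`!)%:R ^+ 2.

(* For 2 <= j <= n the closed form for k_{i+1} is used at i = j - 1; outside
   1 <= j <= n the value is irrelevant. *)
Definition stiffness (R : rcfType) (alpha : R) (n j : nat) : R :=
  if j == 1%N then alpha ^+ 2 * ((2 * n - 1)`!)%:R / ((n - 1)`!)%:R ^+ 2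
  else let i := (j - 1)%N in
    alpha ^+ 2 * ((i`!)%:R * ((2 * n - i - 1)`!)%:R) / ((n - 1)`!)%:R ^+ 2.

Definition mass_mx (R : rcfType) (n : nat) (m : nat -> R) : 'M[R]_n :=
  diag_mx (\row_(i < n) m i.+1).

Definition sqrt_mass_mx (R : rcfType) (n : nat) (m : nat -> R) : 'M[R]_n :=
  diag_mx (\row_(i < n) Num.sqrt (m i.+1)).

Definition inv_sqrt_mass_mx (R : rcfType) (n : nat) (m : nat -> R) : 'M[R]_n :=
  diag_mx (\row_(i < n) (Num.sqrt (m i.+1))^-1).

Definition stiffness_mx (R : rcfType) (n : nat) (k : nat -> R) : 'M[R]_n :=
  sym_tridiag n (fun i => if i == n then k n else k i + k i.+1)
    (fun i => - k i.+1).

(* A with its last row and column deleted (for 0 < n). *)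
Definition del_last (R : rcfType) (n : nat) (A : 'M[R]_n) : 'M[R]_(n.-1) :=
  mxsub (widen_ord (leq_pred n)) (widen_ord (leq_pred n)) A.

Definition gen_eigenvalue (R : rcfType) (n : nat) (A B : 'M[R]_n) (lambda : R)
    : Prop :=
  exists2 x : 'cV[R]_n, x != 0 & (A - lambda *: B) *m x = 0.

(* Main.v *)
(* For j < n, k_j and k_(j+1) are multiples (2n - j)/2 and j/2 of m_j, so the
   equation (C - lambda M) x = 0 is the three-term recurrence satisfied by the
   coefficients of (1 + X)^a (1 - X)^b with a + b = 2n - 2 and lambda = b + 1.
   The symmetry p_(2n-2-j) = (-1)^b p_j of these coefficients yields the boundary
   condition at the right-hand end: for b even it is the last row of C (free end),
   and for b odd it makes the middle coefficient vanish (fixed end). This exhibits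
   n, respectively n - 1, distinct eigenvalues, and there can be no others. *)

Require Import Defs.
From mathcomp Require Import all_boot all_order all_algebra.
From mathcomp Require Import ring lra zify.
Import Order.TTheory GRing.Theory Num.Theory.
Local Open Scope ring_scope.

(** * Tridiagonal products and the number of generalized eigenvalues *)

Lemma sym_tridiag_mul_col (R : rcfType) (n : nat) (d e f : nat -> R) (i : 'I_n) :
  (sym_tridiag n d e *m \col_(j < n) f j) i 0 =
    d i.+1 * f i + (if (i.+1 < n)%N then e i.+1 * f i.+1 else 0)
      + (if i == 0%N :> nat then 0 else e i * f i.-1).
Proof.
(* The three diagonals are split into separate sums. Row 0 needs its guard: as [0.-1 = 0], it would
   otherwise receive a spurious subdiagonal term. *)
pose T j : R := (if j == i :> nat then d i.+1 * f j else 0)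
  + (if j == i.+1 :> nat then e i.+1 * f j else 0)
  + (if i == 0%N :> nat then 0 else if j == i.-1 :> nat then e i * f j else 0).
have pick c (F : nat -> R) : \sum_(j < n) (if j == c :> nat then F j else 0) =
    if (c < n)%N then F c else 0.
  by rewrite -big_mkcond /= big_ord1_eq.
rewrite mxE (eq_bigr (fun j : 'I_n => T j)) => [|j _]; last first.
  rewrite !mxE /T.
  case: (nat_of_ord i) (nat_of_ord j) => [|p] [|q] /=;
    repeat match goal with |- context [?a == ?b] => case: (a =P b) => ? /= end;
    subst; rewrite ?mul0r ?addr0 ?add0r //; lia.
rewrite !big_split /= (pick _ (fun j => d i.+1 * f j)) ltn_ord
  (pick _ (fun j => e i.+1 * f j)); congr (_ + _).
case: (nat_of_ord i) (ltn_ord i) => [|p] lt_p /=; first by rewrite big1.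
by rewrite (pick _ (fun j => e p.+1 * f j)) ltnW.
Qed.

Lemma diag_mx_unit (F : fieldType) (n : nat) (d : 'rV[F]_n) :
  (forall i, d 0 i != 0) -> diag_mx d \in unitmx.
Proof. by move=> d0; rewrite unitmxE det_diag unitfE; apply/prodf_neq0. Qed.

(** Inverting [B] leaves an ordinary eigenvalue equation for [invmx B *m A]; the transpose appears
    because [eigenvalue] is about row vectors. *)
Lemma gen_eigenvalue_root (R : rcfType) (n : nat) (A B : 'M[R]_n) (lambda : R) :
  B \in unitmx -> gen_eigenvalue A B lambda ->
  root (char_poly (invmx B *m A)^T) lambda.
Proof.
move=> uB [x x0 /eqP]; rewrite mulmxBl subr_eq0 -scalemxAl => /eqP Ax.
rewrite -eigenvalue_root_char; apply/eigenvalueP; exists x^T.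
  by rewrite -trmx_mul -mulmxA Ax -scalemxAr mulKmx // linearZ.
by apply: contraNneq x0 => /(congr1 trmx); rewrite trmxK trmx0 => ->.
Qed.

(** Eigenvalues are roots of one polynomial of degree [n], so [n] distinct known ones leave no room
    for another. *)
Lemma gen_eigenvalue_mem (R : rcfType) (n : nat) (A B : 'M[R]_n) (s : seq R) :
  B \in unitmx -> uniq s -> size s = n ->
  (forall mu, mu \in s -> gen_eigenvalue A B mu) ->
  forall lambda, gen_eigenvalue A B lambda -> lambda \in s.
Proof.
move=> uB Us sz_s ev_s lambda ev; apply/negPn/negP => nin.
pose p := char_poly (invmx B *m A)^T.
have p0 : p != 0 by rewrite -size_poly_eq0 size_char_poly.
have := @max_poly_roots _ p (lambda :: s) p0.
rewrite /= nin Us size_char_poly sz_s ltnn => contra.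
suff: false by []; apply: contra => //; rewrite gen_eigenvalue_root //=.
by apply/allP => mu /ev_s; apply: gen_eigenvalue_root.
Qed.

(** * Recurrence and symmetry of the Krawtchouk coefficients *)

(* The coefficients of this polynomial are the values of a Krawtchouk polynomial,
   up to a normalization. *)
Definition kraw (R : comNzRingType) (a b : nat) : {poly R} :=
  (1 + 'X) ^+ a * (1 - 'X) ^+ b.

(** Comparison of the coefficients of X^j in a first-order differential equation. *)
Lemma kraw_rec (R : comNzRingType) (a b j : nat) :
  let p := kraw R a b in
  j.+1%:R * p`_j.+1
    + ((a + b)%:R + 1 - j%:R) * (if j == 0%N then 0 else p`_j.-1)
  = (a%:R - b%:R) * p`_j.
Proof.
move=> p.
(* The extra factor [q] avoids the exponent [c.-1], so [c = 0] is covered too. *)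
have dX (q : {poly R}) c : q * (q ^+ c)^`() = c%:R * q^`() * q ^+ c.
  case: c => [|c]; first by rewrite expr0 derivC mulr0 !mul0r.
  rewrite deriv_exp -mulr_natl /= exprS; ring.
(* p solves (1 - X^2) p' = (a - b) p - (a + b) X p. *)
have ode : p^`() - 'X * ('X * p^`()) =
    (a%:R - b%:R)%:P * p - (a + b)%:R%:P * ('X * p).
  have -> : p^`() - 'X * ('X * p^`()) =
      (1 - 'X) * (1 - 'X) ^+ b * ((1 + 'X) * ((1 + 'X) ^+ a)^`())
      + (1 + 'X) * (1 + 'X) ^+ a * ((1 - 'X) * ((1 - 'X) ^+ b)^`()) :> {poly R}.
    by rewrite /p /kraw derivM; ring.
  rewrite !dX !derivE polyCB !polyC_natr natrD /p /kraw; ring.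
have /(congr1 (fun q : {poly R} => q`_j)) := ode.
rewrite !coefB !coefCM !coefXM !coef_deriv.
move: p {dX ode} => p; move: (a + b)%N => c E.
transitivity ((a%:R - b%:R) * p`_j - c%:R * (if j == 0%N then 0 else p`_j.-1)
  + c%:R * (if j == 0%N then 0 else p`_j.-1)); last by rewrite subrK.
(* The term X^2 p' contributes nothing for [j = 0] and [j = 1], hence three cases. *)
rewrite -{}E; case: j => [|[|j]] /=.
- by rewrite !mulr0 mul1r subr0 !addr0.
- by move: p`_0 p`_2 => x y; ring.
move: p`_j.+3 p`_j.+1 => x y.
rewrite -[x *+ _]mulr_natl -[y *+ _]mulr_natl -[j.+2]addn1 -[j.+1]addn1 !natrD.
by ring.
Qed.

Lemma kraw_sym (R : comNzRingType) (a b j : nat) : (j <= a + b)%N ->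
  (kraw R a b)`_(a + b - j) = (-1) ^+ b * (kraw R a b)`_j.
Proof.
(* Induction on the exponents: multiplying a (skew-)palindromic polynomial by
   1 + X or 1 - X yields a (skew-)palindromic one. *)
move: j; have step (p : {poly R}) N (s c : R) : c * c = 1 -> (size p <= N.+1)%N ->
    (forall j, (j <= N)%N -> p`_(N - j) = s * p`_j) ->
    let q := p * (1 + c *: 'X) in
    (size q <= N.+2)%N /\
    forall j, (j <= N.+1)%N -> q`_(N.+1 - j) = c * s * q`_j.
  move=> cc sz_p sym_p q.
  have qE i : q`_i = p`_i + c * (if i == 0%N then 0 else p`_i.-1).
    by rewrite /q mulrDr mulr1 coefD -scalerAr coefZ coefMX.
  have p_oob : p`_N.+1 = 0 by rewrite nth_default.
  split.
    apply/leq_sizeP => j lt_j.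
    rewrite qE (nth_default 0 (_ : size p <= j)%N); last by lia.
    rewrite (nth_default 0 (_ : size p <= j.-1)%N); last by lia.
    by rewrite if_same mulr0 addr0.
  case=> [|j] le_j; rewrite !qE.
    by have := sym_p 0%N isT; rewrite !subn0 /= p_oob => ->; ring.
  rewrite subSS /=; have sj := sym_p j le_j.
  (* For [j = N] the top coefficient of [q] is paired with its constant one, which has no shifted
     term. *)
  have [eq_j|ne_j] := eqVneq j N.
    have := sj; rewrite eq_j subnn p_oob /= => ->.
    by transitivity (s * (c * c) * p`_N); [rewrite cc|]; ring.
  have sj' : p`_(N - j).-1 = s * p`_j.+1 by rewrite -subnS sym_p //; lia.
  have -> : (N - j == 0)%N = false by lia.
  rewrite sj sj'.
  by transitivity (s * (c * c) * p`_j + c * s * p`_j.+1); [rewrite cc|]; ring.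
suff [_] : (size (kraw R a b) <= (a + b).+1)%N /\ forall j,
  (j <= a + b)%N -> (kraw R a b)`_(a + b - j) = (-1) ^+ b * (kraw R a b)`_j
  by exact.
elim: b => [|b [sz sym]]; last first.
  have [] := step (kraw R a b) (a + b)%N ((-1) ^+ b) (-1) _ sz sym; first by ring.
  by rewrite addnS exprS scaleN1r /kraw -mulrA -exprSr.
rewrite addn0.
elim: a => [|a [sz sym]].
  rewrite /kraw !expr0 mulr1 size_polyC oner_neq0; split=> // -[|j] // _.
  by rewrite mul1r.
have [] := step (kraw R a 0) a ((-1) ^+ 0) 1 _ sz sym; first by ring.
rewrite !expr0 !mul1r scale1r /kraw !expr0 !mulr1 -exprSr => sz' sym'.
by split=> // j le_j; rewrite sym' // mul1r.
Qed.

(** Makes the coefficient vectors nonzero, as eigenvectors must be. *)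
Lemma kraw_coef0 (R : comNzRingType) (a b : nat) : (kraw R a b)`_0 = 1.
Proof.
rewrite -horner_coef0 /kraw !hornerE /= ?addr0 ?subr0 ?oppr0 ?addr0 !expr1n.
by rewrite mulr1.
Qed.

(** * Ratios of stiffnesses to masses *)

(** Since 0! = 1, the general formula also gives k_1. *)
Lemma stiffnessS (R : rcfType) (alpha : R) (n j : nat) :
  stiffness alpha n j.+1 =
    alpha ^+ 2 * (j`!%:R * (2 * n - j.+1)`!%:R) / (n - 1)`!%:R ^+ 2.
Proof.
by case: j => [|j]; rewrite /stiffness /= ?mul1r // subn1 /= -subnDA addn1.
Qed.

(** The bound is strict because at [j.+1 = n] this formula would give twice the last mass. *)
Lemma massS (R : rcfType) (alpha : R) (n j : nat) : (j.+1 < n)%N ->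
  mass alpha n j.+1 =
    2 * alpha ^+ 2 * (j`!%:R * (2 * n - j.+2)`!%:R) / (n - 1)`!%:R ^+ 2.
Proof.
move=> lt_j; rewrite /mass ltn_eqF //.
have -> : (n + (n - j.+1) - 1 = 2 * n - j.+2)%N by lia.
have -> : (n - (n - j.+1) - 1 = j)%N by lia.
by rewrite [j`!%:R * _]mulrC.
Qed.

Lemma mass_last (R : rcfType) (alpha : R) (n : nat) : mass alpha n n = alpha ^+ 2.
Proof. by rewrite /mass eqxx. Qed.

Lemma natr_fact_neq0 (R : numDomainType) (n : nat) : n`!%:R != 0 :> R.
Proof. by rewrite pnatr_eq0 -lt0n fact_gt0. Qed.

(** Together with [stiffness_mass_right] and [stiffness_mass_last], this is all that is used later
    of the closed forms, apart from positivity. *)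
Lemma stiffness_mass_left (R : rcfType) (alpha : R) (n j : nat) : (j.+1 < n)%N ->
  stiffness alpha n j.+1 = (2 * n%:R - j.+1%:R) / 2 * mass alpha n j.+1.
Proof.
move=> lt_j; rewrite stiffnessS massS //.
have -> : (2 * n - j.+1 = (2 * n - j.+2).+1)%N by lia.
have -> : 2 * n%:R - j.+1%:R = (2 * n - j.+2).+1%:R :> R.
  by rewrite -natrM -natrB; [congr _%:R|]; lia.
by rewrite factS natrM; field; apply: natr_fact_neq0.
Qed.

Lemma stiffness_mass_right (R : rcfType) (alpha : R) (n j : nat) : (j.+1 < n)%N ->
  stiffness alpha n j.+2 = j.+1%:R / 2 * mass alpha n j.+1.
Proof.
move=> lt_j; rewrite stiffnessS massS // factS natrM.
by field; apply: natr_fact_neq0.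
Qed.

Lemma stiffness_mass_last (R : rcfType) (alpha : R) (n : nat) : (0 < n)%N ->
  stiffness alpha n n = n%:R * mass alpha n n.
Proof.
case: n => // n _; rewrite stiffnessS mass_last.
have -> : (2 * n.+1 - n.+1 = n.+1)%N by lia.
by rewrite subn1 factS natrM; field; apply: natr_fact_neq0.
Qed.

Lemma mass_gt0 (R : rcfType) (alpha : R) (n j : nat) :
  0 < alpha -> (j < n)%N -> 0 < mass alpha n j.+1.
Proof.
move=> a0; rewrite leq_eqVlt => /predU1P[->|lt_j].
  by rewrite mass_last exprn_gt0.
rewrite massS //.
by rewrite !(divr_gt0, mulr_gt0, exprn_gt0) ?ltr0n ?fact_gt0.
Qed.

Lemma stiffness_gt0 (R : rcfType) (alpha : R) (n j : nat) :
  0 < alpha -> 0 < stiffness alpha n j.+1.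
Proof.
move=> a0; rewrite stiffnessS.
by rewrite !(divr_gt0, mulr_gt0, exprn_gt0) ?ltr0n ?fact_gt0.
Qed.

(** * Factorization of the stiffness matrix *)

Lemma stiffness_mx_factor (R : rcfType) (alpha : R) (n : nat) :
  (2 <= n)%N -> 0 < alpha ->
  stiffness_mx n (stiffness alpha n) =
    sqrt_mass_mx n (mass alpha n) *m Bmx R n *m sqrt_mass_mx n (mass alpha n).
Proof.
move=> n2 a0; apply/matrixP => i j.
rewrite /sqrt_mass_mx mul_mx_diag mul_diag_mx !mxE.
set m := mass alpha n; set k := stiffness alpha n.
have m0 l : (l < n)%N -> 0 < m l.+1 by apply: mass_gt0.
have offdiag l : (l.+1 < n)%N ->
    - k l.+2 = Num.sqrt (m l.+1) *
      (if l.+1 == n.-1 then - Num.sqrt (n%:R * (n%:R - 1) / 2)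
       else - (1 / 2 * Num.sqrt (l.+1%:R * (2 * n%:R - l.+1%:R - 1))))
      * Num.sqrt (m l.+2).
  move=> lt_l; have ml_ge0 : 0 <= m l.+1 by rewrite ltW // m0 // ltnW.
  (* The stiffness is the square root of its square, in which one factor is a multiple of the mass
     on its left and the other of the mass on its right. *)
  rewrite -[k l.+2]gtr0_norm ?stiffness_gt0 // -sqrtr_sqr expr2.
  rewrite {1}/k stiffness_mass_right // -/m.
  (* The spring at the last mass has the ratio n instead of n/2, whence the exceptional entry of
     [Bmx]. *)
  case: eqP => [eq_l|ne_l].
    have -> : k l.+2 = n%:R * m l.+2.
      have -> : l.+2 = n by lia.
      by rewrite /k stiffness_mass_last //; lia.
    have -> : l.+1%:R = n%:R - 1 :> R by rewrite eq_l -subn1 natrB //; lia.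
    have B_ge0 : 0 <= n%:R * (n%:R - 1) / 2 :> R.
      by rewrite divr_ge0 // mulr_ge0 // subr_ge0 ler1n; lia.
    rewrite mulrN mulNr -!sqrtrM ?(mulr_ge0 ml_ge0 B_ge0) //.
    by congr (- Num.sqrt _); field.
  have -> : k l.+2 = (2 * n%:R - l.+2%:R) / 2 * m l.+2.
    by rewrite /k stiffness_mass_left //; lia.
  have B_ge0 : 0 <= l.+1%:R * (2 * n%:R - l.+1%:R - 1) :> R.
    rewrite mulr_ge0 // -addrA -opprD natr1 -natrM subr_ge0 ler_nat; lia.
  have half_sqrt : 1 / 2 = Num.sqrt (1 / 4) :> R.
    rewrite -[LHS]ger0_norm ?divr_ge0 ?ler01 ?ler0n // -sqrtr_sqr.
    by congr Num.sqrt; field.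
  rewrite half_sqrt -sqrtrM ?divr_ge0 ?ler01 ?ler0n // mulrN mulNr.
  rewrite -!sqrtrM ?(mulr_ge0 ml_ge0) ?(mulr_ge0 _ B_ge0) ?divr_ge0 ?ler01
    ?ler0n //.
  by congr (- Num.sqrt _); rewrite -!natr1; field.
have [eq_ij|ne_ij] := eqVneq (i : nat) j.
  rewrite -eq_ij mulrAC -expr2 sqr_sqrtr ?(ltW (m0 _ (ltn_ord i))) //.
  case: eqP => [eq_n|ne_n].
    by rewrite /k stiffness_mass_last -/m; [rewrite eq_n mulrC|lia].
  (* The two ratios at an inner mass add up to (2n - j)/2 + j/2 = n. *)
  have lt_i : (i.+1 < n)%N by case: i {eq_ij} ne_n => /= i; lia.
  by rewrite /k stiffness_mass_left // stiffness_mass_right // -/m; field.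
case: eqP => [eq_j|_].
  by rewrite eq_j; apply: offdiag; rewrite -eq_j.
case: eqP => [eq_i|_].
  rewrite eq_i offdiag -?eq_i // mulrAC [RHS]mulrAC.
  by congr (_ * _); rewrite mulrC.
by rewrite mulr0 mul0r.
Qed.

(** * Eigenvectors from Krawtchouk coefficients *)

Lemma mass_mx_mul_col (R : rcfType) (n : nat) (m f : nat -> R) (i : 'I_n) :
  (mass_mx n m *m \col_(j < n) f j) i 0 = m i.+1 * f i.
Proof. by rewrite /mass_mx mul_diag_mx !mxE. Qed.

Lemma mass_mx_unit (R : rcfType) (alpha : R) (n n' : nat) :
  0 < alpha -> (n' <= n)%N -> mass_mx n' (mass alpha n) \in unitmx.
Proof.
move=> a0 le_n; apply: diag_mx_unit => i.
by rewrite mxE gt_eqF // mass_gt0 // (leq_trans _ le_n).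
Qed.

Lemma del_last_mass_mx (R : rcfType) (n : nat) (m : nat -> R) :
  del_last (mass_mx n m) = mass_mx n.-1 m.
Proof. by apply/matrixP => i j; rewrite !mxE. Qed.

(** The deletion removes the exceptional corner entry, so the diagonal becomes uniform. *)
Lemma del_last_stiffness_mx (R : rcfType) (n : nat) (k : nat -> R) :
  del_last (stiffness_mx n k) =
    sym_tridiag n.-1 (fun i => k i + k i.+1) (fun i => - k i.+1).
Proof.
apply/matrixP => i j; rewrite !mxE /=; case: eqP => // _.
by rewrite ltn_eqF //; case: n i {j} => [|n] [].
Qed.

Lemma gen_eigenvalue_col (R : rcfType) (n : nat) (A B : 'M[R]_n) (lambda : R)
    (f : nat -> R) : (0 < n)%N -> f 0%N != 0 ->
  (forall i : 'I_n, (A *m \col_(j < n) f j) i 0 =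
    lambda * (B *m \col_(j < n) f j) i 0) ->
  gen_eigenvalue A B lambda.
Proof.
move=> n0 f0 fE; exists (\col_(j < n) f j).
  by apply: contraNneq f0 => /matrixP/(_ (Ordinal n0) 0); rewrite !mxE => ->.
apply/matrixP => i j; rewrite ord1 mulmxBl -scalemxAl mxE fE !mxE.
by rewrite subrr.
Qed.

(** Divided by half the mass, the row is [kraw_rec], because 2n - (a - b) = 2(b + 1). *)
Lemma stiffness_kraw_row (R : rcfType) (alpha : R) (n a b j : nat) :
  (a + b = 2 * n - 2)%N -> (j.+1 < n)%N ->
  let p := kraw R a b in let k := stiffness alpha n in
  (k j.+1 + k j.+2) * p`_j - k j.+2 * p`_j.+1
    - (if j == 0%N then 0 else k j.+1 * p`_j.-1)
  = b.+1%:R * (mass alpha n j.+1 * p`_j).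
Proof.
move=> ab lt_j p k; have := kraw_rec R a b j; rewrite /= -/p.
rewrite /k stiffness_mass_left // stiffness_mass_right //.
set m := mass _ _ _.
have abR : a%:R + b%:R + 2 = 2 * n%:R :> R.
  by rewrite -!natrD -natrM; congr _%:R; lia.
have -> : a%:R = 2 * n%:R - 2 - b%:R :> R by rewrite -abR; ring.
have -> : (a + b)%:R = 2 * n%:R - 2 :> R by rewrite natrD -abR; ring.
rewrite -[j.+1%:R]natr1 -[b.+1%:R]natr1 => E.
transitivity (m * (n%:R * p`_j - 2^-1 * ((2 * n%:R - 2 - b%:R - b%:R) * p`_j))).
  by rewrite -E; case: eqP => _; field.
by field.
Qed.

(** For even [b] the symmetry gives p_n = p_(n-2), so [kraw_rec] at n - 1 reads 2n p_(n-2) = (a - b)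
    p_(n-1). *)
Lemma stiffness_kraw_last (R : rcfType) (alpha : R) (n a b : nat) :
  (a + b = 2 * n - 2)%N -> (2 <= n)%N -> ~~ odd b ->
  let p := kraw R a b in let k := stiffness alpha n in
  k n * p`_n.-1 - k n * p`_n.-2 = b.+1%:R * (mass alpha n n * p`_n.-1).
Proof.
move=> ab n2 b_even p k; have := kraw_rec R a b n.-1; rewrite /= -/p.
have := @kraw_sym R a b n.-2; rewrite -/p -signr_odd (negbTE b_even) mul1r.
have -> : (a + b - n.-2 = n)%N by lia.
have -> : n.-1.+1 = n by lia.
have -> : n.-1 == 0%N = false by lia.
move=> -> => [|]; last by lia.
rewrite /k stiffness_mass_last; last by lia.
set m := mass _ _ _.
have abR : a%:R + b%:R + 2 = 2 * n%:R :> R.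
  by rewrite -!natrD -natrM; congr _%:R; lia.
have -> : a%:R = 2 * n%:R - 2 - b%:R :> R by rewrite -abR; ring.
have -> : (a + b)%:R = 2 * n%:R - 2 :> R by rewrite natrD -abR; ring.
have -> : n.-1%:R = n%:R - 1 :> R by rewrite -subn1 natrB //; lia.
rewrite -[b.+1%:R]natr1 => E.
transitivity (m * (n%:R * p`_n.-1 - 2^-1 * (2 * n%:R * p`_n.-2))); first by field.
have -> : 2 * n%:R * p`_n.-2 = (2 * n%:R - 2 - b%:R - b%:R) * p`_n.-1.
  by rewrite -E; ring.
by field.
Qed.

(** Skew symmetry fixes the middle index and forces p_j = -p_j. *)
Lemma kraw_coef_mid (R : rcfType) (a b j : nat) :
  (a + b = j + j)%N -> odd b -> (kraw R a b)`_j = 0.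
Proof.
move=> ab b_odd; have := @kraw_sym R a b j.
rewrite ab addnK leq_addr -signr_odd b_odd mulN1r => /(_ isT) E; lra.
Qed.

Lemma free_end_eigenvalue (R : rcfType) (alpha : R) (n b : nat) :
  (2 <= n)%N -> (b < 2 * n - 1)%N -> ~~ odd b ->
  gen_eigenvalue (stiffness_mx n (stiffness alpha n))
    (mass_mx n (mass alpha n)) b.+1%:R.
Proof.
move=> n2 lt_b b_even; pose a := (2 * n - 2 - b)%N.
have ab : (a + b = 2 * n - 2)%N by rewrite /a; lia.
apply: (@gen_eigenvalue_col _ _ _ _ _ (fun j => (kraw R a b)`_j)); first by lia.
  by rewrite kraw_coef0 oner_neq0.
move=> i; rewrite mass_mx_mul_col sym_tridiag_mul_col.
case: eqP => [eq_n|ne_n].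
  have := stiffness_kraw_last _ alpha _ _ _ ab n2 b_even.
  have -> : n.-1 = i by lia.
  rewrite /= eq_n ltnn addr0 => <-; case: eqP => [i0|_]; first by lia.
  by rewrite mulNr.
have lt_i : (i.+1 < n)%N by have := ltn_ord i; lia.
rewrite lt_i -(stiffness_kraw_row _ alpha _ _ _ _ ab lt_i) !mulNr.
by case: eqP => _ //; rewrite oppr0.
Qed.

Lemma fixed_end_eigenvalue (R : rcfType) (alpha : R) (n b : nat) :
  (2 <= n)%N -> (b < 2 * n - 1)%N -> odd b ->
  gen_eigenvalue (del_last (stiffness_mx n (stiffness alpha n)))
    (del_last (mass_mx n (mass alpha n))) b.+1%:R.
Proof.
move=> n2 lt_b b_odd; pose a := (2 * n - 2 - b)%N.
have ab : (a + b = 2 * n - 2)%N by rewrite /a; lia.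
rewrite del_last_mass_mx del_last_stiffness_mx.
apply: (@gen_eigenvalue_col _ _ _ _ _ (fun j => (kraw R a b)`_j)); first by lia.
  by rewrite kraw_coef0 oner_neq0.
move=> i; rewrite mass_mx_mul_col sym_tridiag_mul_col.
have lt_i : (i.+1 < n)%N by have := ltn_ord i; lia.
rewrite -(stiffness_kraw_row _ alpha _ _ _ _ ab lt_i) !mulNr.
(* The only term lost by the deletion involves p_(n-1), the middle coefficient, which vanishes. *)
have -> : (if (i.+1 < n.-1)%N then
      - (stiffness alpha n i.+2 * (kraw R a b)`_i.+1) else 0) =
    - (stiffness alpha n i.+2 * (kraw R a b)`_i.+1).
  case: ltnP => // le_n; rewrite [_`_i.+1]kraw_coef_mid ?mulr0 ?oppr0 //; lia.
by case: eqP => _ //; rewrite oppr0.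
Qed.

(** * The vector [u] and the two spectra *)

(** A uniform displacement stretches only the spring at the wall. *)
Lemma stiffness_mx_mul1 (R : rcfType) (n : nat) (k : nat -> R) (i : 'I_n) :
  (stiffness_mx n k *m const_mx 1 : 'cV_n) i 0 =
    if i == 0%N :> nat then k 1%N else 0.
Proof.
have -> : const_mx 1 = \col_(j < n) (fun=> 1) (nat_of_ord j) :> 'cV[R]_n.
  by apply/matrixP => p q; rewrite !mxE.
rewrite (sym_tridiag_mul_col _ _ _ _ (fun=> 1)) !mulr1.
case: (ltngtP i.+1 n) (ltn_ord i) => // [lt_i _|eq_n _].
  by case: eqP => [->|_]; ring.
by case: eqP => [i0|_]; [rewrite -eq_n i0|rewrite eq_n]; ring.
Qed.

Theorem mainTheorem3 (R : rcfType) (n : nat) (alpha : R)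
    (hn : (2 <= n)%N) (halpha : 0 < alpha) :
  let m := mass alpha n in
  let k := stiffness alpha n in
  let B := Bmx R n in
  let M := mass_mx n m in
  let C := stiffness_mx n k in
  let u : 'cV[R]_n := \col_(i < n) Num.sqrt (m i.+1) in
  [/\ forall j : nat, (1 <= j <= n)%N -> 0 < m j /\ 0 < k j,
      B *m u =
        \col_(i < n) (if i == 0%N :> nat then (Num.sqrt (m 1%N))^-1 * k 1%N
                      else 0),
      C = sqrt_mass_mx n m *m B *m sqrt_mass_mx n m /\
      inv_sqrt_mass_mx n m *m C *m inv_sqrt_mass_mx n m = B,
      forall lambda : R, gen_eigenvalue C M lambda <->
        exists2 j : nat, (1 <= j <= n)%N & lambda = (2 * j - 1)%:R
    & forall lambda : R, gen_eigenvalue (del_last C) (del_last M) lambda <->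
        exists2 j : nat, (1 <= j <= n - 1)%N & lambda = (2 * j)%:R].
Proof.
move=> m k B M C u.
have CE : C = sqrt_mass_mx n m *m B *m sqrt_mass_mx n m.
  exact: stiffness_mx_factor.
have s0 (i : 'I_n) : Num.sqrt (m i.+1) != 0.
  by rewrite gt_eqF // sqrtr_gt0 mass_gt0.
have isK : inv_sqrt_mass_mx n m *m sqrt_mass_mx n m = 1%:M.
  apply/matrixP => i j; rewrite /inv_sqrt_mass_mx mul_diag_mx !mxE.
  by case: eqP => [->|_]; rewrite ?mulr0 // mulVf.
have siK := mulmx1C isK.
(* With the factorization of [C], this reduces [B *m u] to the row sums of [C], scaled by
   M^(-1/2). *)
have uE : u = sqrt_mass_mx n m *m const_mx 1.
  by apply/matrixP => i j; rewrite /sqrt_mass_mx mul_diag_mx !mxE mulr1.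
split.
- by case=> [|j] // /andP[_ lt_j]; split; [apply: mass_gt0|apply: stiffness_gt0].
- have -> : B *m u = inv_sqrt_mass_mx n m *m (C *m const_mx 1).
    by rewrite uE CE -!mulmxA (mulmxA (inv_sqrt_mass_mx n m)) isK mul1mx.
  apply/matrixP => i j; rewrite ord1 /inv_sqrt_mass_mx mul_diag_mx.
  rewrite [LHS]mxE stiffness_mx_mul1 !mxE.
  by case: eqP => [->//|_]; rewrite mulr0.
- by split=> //; rewrite CE -!mulmxA siK mulmx1 mulmxA isK mul1mx.
- have ev j : (1 <= j <= n)%N -> gen_eigenvalue C M (2 * j - 1)%:R.
    (* The eigenvalue is b + 1 with [b = 2 * j] even. *)
    case: j => // j le_j; have -> : (2 * j.+1 - 1 = (2 * j).+1)%N by lia.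
    by apply: free_end_eigenvalue; rewrite ?oddM; lia.
  move=> lambda; split=> [|[j le_j ->]]; last exact: ev.
  pose s : seq R := [seq (2 * j - 1)%:R | j <- iota 1 n].
  move/(@gen_eigenvalue_mem _ _ _ _ s).
  case/(_ _ _ _ _)/mapP => [||||j]; rewrite ?size_map ?size_iota //.
  + exact: mass_mx_unit.
  + rewrite map_inj_in_uniq ?iota_uniq // => i j; rewrite !mem_iota => ? ?.
    by move/eqP; rewrite eqr_nat; lia.
  + by move=> mu /mapP[j]; rewrite mem_iota => j_in ->; apply: ev; lia.
  + by rewrite mem_iota => j_in ->; exists j => //; lia.
- have ev j : (1 <= j <= n - 1)%N ->
      gen_eigenvalue (del_last C) (del_last M) (2 * j)%:R.
    (* Here [b = (2 * j).+1] is odd. *)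
    case: j => // j le_j; have -> : (2 * j.+1 = (2 * j).+2)%N by lia.
    by apply: fixed_end_eigenvalue; rewrite //= ?oddM; lia.
  move=> lambda; split=> [|[j le_j ->]]; last exact: ev.
  pose s : seq R := [seq (2 * j)%:R | j <- iota 1 (n - 1)].
  move/(@gen_eigenvalue_mem _ _ _ _ s).
  case/(_ _ _ _ _)/mapP => [||||j]; rewrite ?size_map ?size_iota ?subn1 //.
  + by rewrite del_last_mass_mx; apply: mass_mx_unit; rewrite ?leq_pred.
  + rewrite map_inj_in_uniq ?iota_uniq // => i j; rewrite !mem_iota => ? ?.
    by move/eqP; rewrite eqr_nat; lia.
  + by move=> mu /mapP[j]; rewrite mem_iota => j_in ->; apply: ev; lia.
  + by rewrite mem_iota => j_in ->; exists j => //; lia.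
Qed.
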